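(* For an analytic mid-convex subset $A$ of a Polish group $X$ the following conditions are equivalent: (1) $A-A$ is not a neighborhood of zero in $X$; (2) $A-A$ is meager in $X$; (3) $A$ is generically Haar-$1$; (4) $A$ is Haar-thin; (5) $A$ is null-$n$ for some $n\in\mathbb N$.
   Context: All groups are Abelian, written additively; a Polish group is a topological group whose underlying space is Polish. $\mathbb N=\{1,2,\dots\}$. A space is analytic if it is a continuous image of a Polish space. For $c\in X$ put $\frac12c:=\{x\in X:x+x=c\}$. A subset $A$ of a group $X$ is mid-convex if $\emptyset\neq\frac12(a+b)\subset A$ for any $a,b\in A$. Smallness notions for $A\subset X$ ($2^\omega=\{0,1\}^\omega$ is the Cantor cube). Generically Haar-$1$: the set $\{f\in C(2^\omega,X):\forall x\in X\;|f^{-1}(A+x)|\le1\}$ is comeager in the space $C(2^\omega,X)$ of continuous maps with the compact-open topology. Haar-thin: there is a continuous $f:2^\omega\to X$ such that for every $x\in X$ the set $f^{-1}(A+x)$ is thin, where $T\subset2^\omega$ is thin if for every $n\in\omega$ the map $T\ni x\mapsto x|_{\omega\setminus\{n\}}$ is injective. Null-$n$: there is a continuous map $f:\omega+1\to X$ ($\omega+1$ with the order topology) such that $|f^{-1}(A+x)|\le n$ for every $x\in X$. *)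

(* Defs.v *)
From HB Require Import structures.
From mathcomp Require Import all_boot all_order all_algebra.
From mathcomp Require Import all_classical all_reals all_analysis.

Set Implicit Arguments.
Unset Strict Implicit.
Unset Printing Implicit Defensive.

Import Order.TTheory GRing.Theory Num.Theory.
Local Open Scope classical_set_scope.
Local Open Scope card_scope.
Local Open Scope ring_scope.

Section category.
Context {T : topologicalType}.
Implicit Type S : set T.

Definition nowhere_dense S := interior (closure S) = set0.

Definition meager S :=
  exists2 F : (set T)^nat, (forall n, nowhere_dense (F n)) & S `<=` \bigcup_n F n.

Definition comeager S := meager (~` S).

End category.

Section polish.
Variable R : realType.

Definition separable (T : topologicalType) :=
  exists2 D : set T, countable D & dense D.

Definition complete_metric (M : metricType R) :=
  forall F : set_system M, ProperFilter F -> cauchy F -> exists x : M, F --> x.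

Definition completely_metrizable (T : topologicalType) :=
  exists2 M : metricType R, complete_metric M &
  exists (f : T -> M) (g : M -> T),
    [/\ continuous f, continuous g, cancel f g & cancel g f].

Definition polish (T : topologicalType) :=
  separable T /\ completely_metrizable T.

(* The spaces [P] need not be pointed, so the empty set is analytic. *)
Definition analytic (T : topologicalType) (A : set T) :=
  exists2 P : topologicalType, polish P &
  exists2 f : P -> T, continuous f & range f = A.

End polish.

(* The ordinal omega + 1: [Some n] is n, and [None] is the top element omega. *)
Definition omega_succ : Type := option nat.

HB.instance Definition _ := Choice.on omega_succ.

Definition omega_succ_le (x y : omega_succ) : bool :=
  match x, y with
  | _, None => true
  | None, Some _ => false
  | Some m, Some n => (m <= n)%N
  end.

Lemma omega_succ_le_refl : reflexive omega_succ_le.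
Proof. by case=> [n|] //=. Qed.

Lemma omega_succ_le_anti : antisymmetric omega_succ_le.
Proof. by case=> [m|] [n|] //= /anti_leq ->. Qed.

Lemma omega_succ_le_trans : transitive omega_succ_le.
Proof. by case=> [m|] [n|] [p|] //=; exact: leq_trans. Qed.

Lemma omega_succ_le_total : total omega_succ_le.
Proof. by case=> [m|] [n|] //=; exact: leq_total. Qed.

HB.instance Definition _ := Order.Le_isPOrder.Build Order.default_display
  omega_succ omega_succ_le_refl omega_succ_le_anti omega_succ_le_trans.

HB.instance Definition _ := Order.POrder_isTotal.Build Order.default_display
  omega_succ omega_succ_le_total.

(* [T] is thin when forgetting any one coordinate is injective on [T]. *)
Definition thin (T : set cantor_space) :=
  forall n : nat, set_inj T (fun x : cantor_space => sigL (~` [set n]) x).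

Section small_sets.
Context {X : topologicalZmodType}.
Implicit Type A : set X.

Definition half (c : X) : set X := [set x | x + x = c].

Definition mid_convex A := forall a b, A a -> A b ->
  half (a + b) !=set0 /\ half (a + b) `<=` A.

Definition translate A (x : X) : set X := [set a + x | a in A].

Definition difference A : set X := [set a - b | a in A & b in A].

(* This import gives [continuousType U V] its compact-open topology. *)
Import ArrowAsCompactOpen.

Definition generically_haar1 A := comeager
  [set f : continuousType cantor_space X |
    forall x, f @^-1` translate A x #<= `I_1].

Definition haar_thin A :=
  exists2 f : cantor_space -> X, continuous f &
  forall x, thin (f @^-1` translate A x).

Definition null_n (n : nat) A :=
  exists2 f : order_topology omega_succ -> X, continuous f &
  forall x, f @^-1` translate A x #<= `I_n.

End small_sets.

(* Main.v *)
Require Import Defs.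
From mathcomp Require Import all_boot all_order all_algebra.
From mathcomp Require Import all_classical all_reals all_analysis.
From mathcomp Require Import lra.

Set Implicit Arguments.
Unset Strict Implicit.
Unset Printing Implicit Defensive.

Import Order.TTheory GRing.Theory Num.Theory.
Local Open Scope classical_set_scope.
Local Open Scope card_scope.
Local Open Scope ring_scope.

(** Write D for [difference A]. The argument is a web of implications around
    the two statements that D is not a neighborhood of zero and that D is
    meager; mid-convexity and analyticity enter at separate places.

    If D is not a neighborhood of zero then D is meager. A Suslin scheme of D,
    built from a dense sequence in a Polish space parametrizing A, shows that a
    nonmeager D is comeager in some nonempty open set
    ([analytic_difference_comeager]); by the theorem of Pettis D - D is then a
    neighborhood of zero ([pettis]). Now D is symmetric and mid-convex, so v is
    in D as soon as 2v is in D - D = D + D, and D itself is a neighborhood of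
    zero ([nbhs_difference_mid_convex]).

    If D is meager then A is generically Haar-1. Two points x and y of the
    Cantor cube are sent by f into one translate of A exactly when f x - f y is
    in D. The maps f with f x - f y in a given nowhere dense set for some x, y
    that already differ within the first m coordinates form a nowhere dense
    set: f is close to a map depending on finitely many coordinates only, and
    its finitely many values can be moved apart ([nowhere_dense_hit]).

    If A is generically Haar-1 then some continuous f sends no two points into
    one translate of A, because the space of maps is completely metrizable and
    hence not meager in itself. Such an f witnesses that A is Haar-thin, and
    its restriction to a convergent sequence that A is null-1.

    Conversely, suppose that D is a neighborhood of zero. If f is a continuous
    map on the Cantor cube then f 0 and f e are in one translate of A when e is
    a sequence with a single 1 that is far enough, so A is not Haar-thin
    ([haar_thin_not_nbhs]). If f maps a convergent sequence into X then, by
    taking iterated midpoints, any 2^k of its far enough terms are put into one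
    translate of A ([mid_convex_translate]), so A is not null-n. *)

(** * Meager sets *)

Section meager_sets.
Context {T : topologicalType}.
Implicit Types (S N O : set T).

(** The form in which nowhere density is both used and proved below: it speaks
    of open sets only, and so transfers along homeomorphisms and needs no
    closures in function spaces. *)
Lemma nowhere_denseP N : nowhere_dense N <->
  forall O, open O -> O !=set0 ->
  exists O', [/\ open O', O' !=set0, O' `<=` O & O' `&` N = set0].
Proof.
split=> [N0 O oO [x Ox]|H].
  exists (O `\` closure N); split.
  - by apply: openI => //; apply: closed_openC; exact: closed_closure.
  - apply: nonsubset => ON.
    have : interior (closure N) x by apply: filterS ON _; exact: open_nbhs_nbhs.
    by rewrite N0.
  - exact: subDsetl.
  - by apply/seteqP; split=> // y [[_ nNy] /subset_closure].
apply/seteqP; split=> // x xN.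
have [|O' [oO' [y O'y] O'N O'0]] := H _ (open_interior (closure N)).
  by exists x.
have /(_ O') [|z [Nz O'z]] := interior_subset (O'N _ O'y).
  exact: open_nbhs_nbhs.
by have : set0 z by rewrite -O'0.
Qed.

Lemma nowhere_dense0 : nowhere_dense (set0 : set T).
Proof. by rewrite /nowhere_dense closure0 interior0. Qed.

Lemma nowhere_dense_frontier S : closed S -> nowhere_dense (S `\` interior S).
Proof.
move=> cS; rewrite /nowhere_dense.
have /closure_id <- : closed (S `\` interior S).
  by apply: closedI => //; apply: open_closedC; exact: open_interior.
apply/seteqP; split=> // x; rewrite /interior => xS.
have [_] := nbhs_singleton xS; apply.
by apply: filterS xS; exact: subDsetl.
Qed.

Lemma nowhere_dense_meager N : nowhere_dense N -> meager N.
Proof. by move=> N0; exists (fun=> N) => // x Nx; exists 0%N. Qed.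

Lemma meager0 : meager (set0 : set T).
Proof. exact/nowhere_dense_meager/nowhere_dense0. Qed.

Lemma meager_sub S N : S `<=` N -> meager N -> meager S.
Proof. by move=> SN [F F0 NF]; exists F => //; exact: subset_trans NF. Qed.


Lemma meager_bigcup (I : countType) (F : I -> set T) :
  (forall i, meager (F i)) -> meager (\bigcup_i F i).
Proof.
move=> mF.
have /choice[G GP] : forall i, exists G : (set T)^nat,
    (forall n, nowhere_dense (G n)) /\ F i `<=` \bigcup_n G n.
  by move=> i; have [G G0 FG] := mF i; exists G.
exists (fun m => if choice.unpickle m is Some (i, k) then G i k else set0).
  move=> m; case: (choice.unpickle m) => [[i k]|]; last exact: nowhere_dense0.
  by have [] := GP i.
move=> x [i _ Fx]; have [_ /(_ x Fx)[k _ Gx]] := GP i.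
by exists (choice.pickle (i, k)) => //; rewrite choice.pickleK.
Qed.

Lemma meager_bigcup_countable (I : Type) (D : set I) (F : I -> set T) :
  countable D -> (forall i, D i -> meager (F i)) ->
  meager (\bigcup_(i in D) F i).
Proof.
move=> /pfcard_geP[->|[s]] mF; first by rewrite bigcup_set0; exact: meager0.
apply: meager_sub (meager_bigcup (F := fun n => F (s n)) _).
  by move=> x [i /(@surj _ _ _ _ s)[n _ <-] Fx]; exists n.
by move=> n; apply: mF; exact: funS.
Qed.

Lemma meagerU S N : meager S -> meager N -> meager (S `|` N).
Proof.
move=> mS mN.
apply: meager_sub (meager_bigcup (F := fun b : bool => if b then S else N) _).
  by move=> x [Sx|Nx]; [exists true|exists false].
by case.
Qed.

End meager_sets.

(** * The Baire category theorem for completely metrizable spaces *)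

(** A complete pseudometric for the topology of T, by its balls. It is kept apart from the type T
    because it is needed on spaces that carry their own topology: a topological
    group, and the maps from the Cantor cube with the compact-open topology. *)
Record complete_balls (R : realType) (T : topologicalType)
    (B : T -> R -> set T) : Prop := CompleteBalls {
  cballs_center : forall x e, 0 < e -> B x e x;
  cballs_sym : forall x y e, B x e y -> B y e x;
  cballs_triangle : forall x y z d e, B x d y -> B y e z -> B x (d + e) z;
  cballs_nbhs : forall x U, nbhs x U <-> exists2 e, 0 < e & B x e `<=` U;
  cballs_complete : forall u : nat -> T,
    (forall e, 0 < e -> exists N, forall m n, (N <= m)%N -> (N <= n)%N ->
       B (u m) e (u n)) ->
    exists l, forall e, 0 < e -> exists N, forall n, (N <= n)%N -> B l e (u n)
}.

Section complete_balls_theory.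
Context {R : realType} {T : topologicalType} {B : T -> R -> set T}.
Hypothesis cB : complete_balls B.

Lemma cballs_mono x d e : d <= e -> B x d `<=` B x e.
Proof.
rewrite le_eqVlt => /predU1P[->//|de] y xy.
rewrite -(subrK d e) addrC; apply: cballs_triangle xy _ => //.
by apply: cballs_center => //; rewrite subr_gt0.
Qed.

Lemma cballs_nbhsx x e : 0 < e -> nbhs x (B x e).
Proof. by move=> e0; apply/(cballs_nbhs cB); exists e. Qed.

(** Inside a ball contained in S, choose smaller and smaller balls, the n-th one
    avoiding the n-th nowhere dense set of a cover of S; their centers converge
    to a point of S missed by the cover. The invariant keeps the ball of double
    radius inside the preceding ball, which catches the limit without passing to
    closed balls. *)
Lemma baire_category (S : set T) : meager S -> interior S = set0.
Proof.
move=> [F F0 SF]; apply/seteqP; split=> // x0.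
move=> /(cballs_nbhs cB)[e0 e0_gt0 BS].
have /choice[step stepP] : forall a : nat * (T * R), exists q : T * R,
    0 < a.2.2 -> [/\ 0 < q.2, q.2 <= a.1.+1%:R^-1,
      B q.1 (q.2 + q.2) `<=` B a.2.1 a.2.2 &
      B q.1 (q.2 + q.2) `&` F a.1 = set0].
  move=> [n [x e]] /=.
  have [e_gt0|] := ltP 0 e; last by exists (x, e).
  have /nowhere_denseP/(_ _ (open_interior (B x e)))[|O [oO [y Oy] OB OF]] := F0 n.
    by exists x; exact: cballs_nbhsx.
  have /(cballs_nbhs cB)[r r0 rO] : nbhs y O by exact: open_nbhs_nbhs.
  exists (y, Num.min (r / 2) n.+1%:R^-1) => _ /=.
  have sub : B y (Num.min (r / 2) n.+1%:R^-1 + Num.min (r / 2) n.+1%:R^-1) `<=` O.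
    apply: subset_trans rO; apply: cballs_mono.
    by rewrite [leRHS]splitr lerD// ge_min lexx.
  split.
  - by rewrite lt_min divr_gt0//= invr_gt0.
  - by rewrite ge_min lexx orbT.
  - exact: subset_trans sub (subset_trans OB (@interior_subset _ _)).
  - by apply/seteqP; split=> // z [/sub Oz Fz]; rewrite -OF.
pose s := fix s n := if n is m.+1 then step (m, s m) else (x0, e0).
have s_gt0 n : 0 < (s n).2.
  by elim: n => //= n IH; have [] := stepP (n, s n) IH.
have sP n := stepP (n, s n) (s_gt0 n).
have half_sub n : B (s n).1 (s n).2 `<=` B (s n).1 ((s n).2 + (s n).2).
  by apply: cballs_mono; rewrite lerDl ltW.
have nest m n : (n <= m)%N -> B (s m).1 (s m).2 `<=` B (s n).1 (s n).2.
  elim: m => [|m IH]; first by rewrite leqn0 => /eqP ->.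
  rewrite leq_eqVlt => /predU1P[->//|/IH]; apply: subset_trans.
  by have [_ _ sub _] := sP m; apply: subset_trans sub; exact: half_sub.
have s_in m n : (n <= m)%N -> B (s n).1 (s n).2 (s m).1.
  by move=> nm; apply: nest nm _ _; exact: cballs_center.
have [e e_gt0|l lP] := cballs_complete cB (u := fun n => (s n).1).
  have e2_gt0 : 0 < e / 2 by rewrite divr_gt0.
  have [N _ /(_ N (leqnn N)) Ne] := near_infty_natSinv_lt (PosNum e2_gt0).
  exists N.+1 => m n Nm Nn; rewrite [e]splitr.
  have [_ sN _ _] := sP N.
  have sub : B (s N.+1).1 (s N.+1).2 `<=` B (s N.+1).1 (e / 2).
    by apply: cballs_mono; rewrite (le_trans sN)// ltW.
  apply: cballs_triangle (cballs_sym cB (sub _ (s_in _ _ Nm))) (sub _ (s_in _ _ Nn)).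
  exact: cB.
have l_in n : B (s n).1 ((s n).2 + (s n).2) l.
  have [N NP] := lP _ (s_gt0 n).
  apply: cballs_triangle (s_in _ _ (leq_maxr N n)) _ => //.
  by apply: (cballs_sym cB); apply: NP; exact: leq_maxl.
have [n _ Fl] : (\bigcup_n F n) l.
  by apply: SF; apply: BS; have [_ _ sub _] := sP 0%N; apply: sub; exact: (l_in 1%N).
have [_ _ _ disj] := sP n.
by have : set0 l by rewrite -disj; split => //; exact: (l_in n.+1).
Qed.

End complete_balls_theory.

Lemma completely_metrizable_balls (R : realType) (T : topologicalType) :
  completely_metrizable R T ->
  exists B : T -> R -> set T, complete_balls B.
Proof.
move=> [M cM [f [g [cf cg fK gK]]]].
exists (fun x e => f @^-1` ball (f x) e); split.
- by move=> x e e0; exact: ballxx.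
- by move=> x y e; exact: ball_sym.
- by move=> x y z d e; exact: ball_triangle.
- move=> x U; split=> [xU|[e e0 eU]].
    have : nbhs (f x) (g @^-1` U) by apply: cg; rewrite fK.
    move=> /nbhs_ballP[e e0 eU]; exists e => // y /eU.
    by rewrite /= fK.
  by apply: filterS eU _; apply: cf; exact: nbhsx_ballx.
- move=> u uC; pose F := f (u n) @[n --> \oo].
  have FC : cauchy F.
    apply: cauchy_exP => e e0; have [N NP] := uC e e0.
    by exists (f (u N)), N => // n Nn; exact: NP.
  have [l Fl] := cM F _ FC; exists (g l) => e e0.
  have [N _ NP] := Fl _ (nbhsx_ballx l e e0).
  by exists N => n Nn; rewrite /= gK; exact: NP.
Qed.

Lemma completely_metrizable_hausdorff (R : realType) (T : topologicalType) :
  completely_metrizable R T -> hausdorff_space T.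
Proof.
move=> [M _ [f [g [cf _ fK _]]]] x y xy.
apply: (can_inj fK); apply: (@metric_hausdorff R M) => U V Ux Vy.
have [z [Uz Vz]] := xy _ _ (cf _ _ Ux) (cf _ _ Vy).
by exists (f z).
Qed.

(** * Suslin schemes and the Baire property *)

Definition has_countable_base (T : topologicalType) :=
  exists2 b : set (set T), countable b /\ (forall O, b O -> open O) &
  forall x U, nbhs x U -> exists O, [/\ b O, O x & O `<=` U].

(** As balls need not be open sets here, the base consists of the interiors of
    balls around the points of a dense set. *)
Lemma polish_countable_base (R : realType) (T : topologicalType) :
  polish R T -> has_countable_base T.
Proof.
move=> [[D cD dD] /completely_metrizable_balls[B cB]].
pose b (p : T * nat) := interior (B p.1 p.2.+1%:R^-1).
exists [set b p | p in D `*` setT].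
  split.
    apply: card_le_trans (card_image_le _ _) _.
    by apply: countableX => //; exact: countableP.
  by move=> _ [p _ <-]; exact: open_interior.
move=> x U /(cballs_nbhs cB)[e e_gt0 eU].
have e2_gt0 : 0 < e / 2 by rewrite divr_gt0.
have [n _ /(_ n (leqnn n))] := near_infty_natSinv_lt (PosNum e2_gt0).
set r : R := n.+1%:R^-1 => /= re.
have r2_gt0 : 0 < r / 2 by rewrite divr_gt0// invr_gt0.
have [|d [xd Dd]] := dD (interior (B x (r / 2))) _ (open_interior _).
  by exists x; exact: cballs_nbhsx.
move/interior_subset in xd; exists (b (d, n)); split.
- by exists (d, n).
- apply/(cballs_nbhs cB); exists (r / 2) => // y xy.
  by rewrite /= -/r [r]splitr; apply: cballs_triangle xy => //; exact: cballs_sym.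
- move=> y /interior_subset /= dy; apply: eU.
  apply: (cballs_mono cB (d := r / 2 + r)); first by lra.
  exact: cballs_triangle dy.
Qed.

Section locally_nonmeager.
Context {X : topologicalType}.
Hypothesis bX : has_countable_base X.
Implicit Types (S O : set X).

Definition everywhere_nonmeager S : set X :=
  [set x | forall U, nbhs x U -> ~ meager (S `&` U)].

Lemma closed_everywhere_nonmeager S : closed (everywhere_nonmeager S).
Proof.
move=> x clx U; rewrite nbhsE => -[V [oV Vx] VU] mSU.
have [y [Sy Vy]] := clx V (open_nbhs_nbhs (conj oV Vx)).
apply: (Sy V (open_nbhs_nbhs (conj oV Vy))).
by apply: meager_sub mSU; exact: setIS.
Qed.

Lemma everywhere_nonmeager_closure S : everywhere_nonmeager S `<=` closure S.
Proof.
move=> x Sx U /Sx SU; apply: contrapT => /nonemptyPn S0.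
by apply: SU; rewrite S0; exact: meager0.
Qed.

(** A point of S that is not in [everywhere_nonmeager S] has a basic
    neighborhood in which S is meager, and there are countably many of these. *)
Lemma meager_everywhere_nonmeagerD S : meager (S `\` everywhere_nonmeager S).
Proof.
have [b [cb ob] bP] := bX.
have cb' : countable (b `&` [set O | meager (S `&` O)]).
  by move: cb; apply: card_le_trans; apply: subset_card_le; exact: subIsetl.
apply: meager_sub (meager_bigcup_countable cb' (F := fun O => S `&` O) _).
  move=> x [Sx /existsNP[U /not_implyP[xU /contrapT mSU]]].
  have [W [bW Wx WU]] := bP x U xU.
  by exists W => //; split=> //; apply: meager_sub mSU; exact: setIS.

by move=> O [].
Qed.

(** Otherwise S would be covered, inside O, by its part outside
    [everywhere_nonmeager S] and the frontier of that closed set. *)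
Lemma interior_everywhere_nonmeager S O : open O -> ~ meager (S `&` O) ->
  interior (everywhere_nonmeager S) `&` O !=set0.
Proof.
move=> oO nm; apply: contrapT => /nonemptyPn E0; apply: nm.
apply: meager_sub (meagerU (meager_everywhere_nonmeagerD S)
  (nowhere_dense_meager (nowhere_dense_frontier (closed_everywhere_nonmeager (S:=S))))).
move=> x [Sx Ox].
have [Ex|nEx] := pselect (everywhere_nonmeager S x); last by left.
by right; split=> // iEx; have : set0 x by rewrite -E0.
Qed.

(** The first n choices of a, the last one at the head, so that prolonging a
    node of a scheme is [cons]. *)
Fixpoint branch (I : Type) (a : nat -> I) (n : nat) : seq I :=
  if n is m.+1 then a m :: branch a m else [::].

(** The classical proof that the Suslin operation preserves the Baire property,
    in one-sided form. Let V s be the interior of the set where S s is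
    everywhere nonmeager. The sets V (i :: s) are dense in V s, since S s is the
    union of the S (i :: s). So apart from a meager set, every point of V [::]
    follows a branch whose nodes all accumulate at it. *)
Lemma suslin_scheme_baire (I : countType) (S : seq I -> set X) :
  (forall s, S s `<=` \bigcup_i S (i :: s)) ->
  (forall x (a : nat -> I), (forall n, closure (S (branch a n)) x) ->
     S [::] x) ->
  meager (interior (everywhere_nonmeager (S [::])) `\` S [::]).
Proof.
move=> Scover Sbranch.
pose V s := interior (everywhere_nonmeager (S s)).
have V_next s : nowhere_dense (V s `\` \bigcup_i V (i :: s)).
  apply/nowhere_denseP => O oO O0.
  have [[y [Oy Vy]]|] := pselect (O `&` V s !=set0); last first.
    move=> /nonemptyPn OV; exists O; split => //.
    by rewrite setDE setIA OV set0I.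
  have [x [[i _ Vx] OVx]] : (\bigcup_i V (i :: s)) `&` (O `&` V s) !=set0.
    have nm : ~ meager (S s `&` (O `&` V s)).
      apply: (interior_subset Vy); apply: open_nbhs_nbhs; split=> //.
      by apply: openI => //; exact: open_interior.
    have [i nmi] : exists i, ~ meager (S (i :: s) `&` (O `&` V s)).
      apply: contrapT => /forallNP/= mi; apply: nm.
      apply: meager_sub (meager_bigcup (F := fun i => S (i :: s) `&` (O `&` V s)) _).
        by move=> x [/Scover[i _ Si] Ox]; exists i.
      by move=> i; exact: contrapT (mi i).
    have [|x [Vx Ox]] := interior_everywhere_nonmeager _ nmi.
      by apply: openI => //; exact: open_interior.
    by exists x; split=> //; exists i.
  exists (O `&` V (i :: s)); split.
  - by apply: openI => //; exact: open_interior.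
  - by exists x; split=> //; case: OVx.
  - exact: subIsetl.
  - by apply/seteqP; split=> // z [[_ Vz] [_]]; apply; exists i.
apply: meager_sub (meager_bigcup (F := fun s => V s `\` \bigcup_i V (i :: s)) _);
  last by move=> s; exact: nowhere_dense_meager.
move=> x [Vx nSx]; apply: contrapT => nU.
have nN s : ~ (V s `\` \bigcup_i V (i :: s)) x by move=> Ns; apply: nU; exists s.
(* Off V s any index would do, and one is provided by the root. *)
have /choice[next nextP] : forall s, exists i, V s x -> V (i :: s) x.
  move=> s; have [Vs|nVs] := pselect (V s x); last first.
    apply: contrapT => /forallNP noi; apply: (nN [::]); split=> //.
    by move=> -[i _ _]; apply: (noi i).
  apply: contrapT => /forallNP noi; apply: (nN s); split=> // -[i _ Vi].
  by apply: (noi i).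
pose p := fix p n := if n is m.+1 then next (p m) :: p m else [::].
have pE n : branch (fun m => next (p m)) n = p n.
  by elim: n => //= n ->.
have Vp n : V (p n) x by elim: n => //= n /nextP.
apply: nSx; apply: (Sbranch x (fun m => next (p m))) => n; rewrite pE.
by apply: everywhere_nonmeager_closure; exact: interior_subset (Vp n).
Qed.

End locally_nonmeager.

(** * The difference set of an analytic mid-convex set *)

(** Nodes are intersections of balls of radii 1, 1/2, 1/3, ... centered on a
    dense sequence. Along a branch with nonempty nodes the diameters tend to
    zero, and completeness gives the point to which the nodes shrink. *)
Lemma polish_scheme (R : realType) (P : topologicalType) (p0 : P) :
  polish R P -> exists W : seq nat -> set P,
  [/\ W [::] = setT, forall s, W s `<=` \bigcup_i W (i :: s) &
      forall a : nat -> nat, (forall n, W (branch a n) !=set0) ->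
      exists p : P, forall U, nbhs p U ->
      exists N, forall n, (N <= n)%N -> W (branch a n) `<=` U].
Proof.
move=> [[D cD dD] /completely_metrizable_balls[B cB]].
have [d dD'] : exists d : nat -> P, forall (x : P) U, nbhs x U -> exists i, U (d i).
  have [DE|[d]] := pfcard_geP cD.
    have [|x [_]] := dD setT _ openT; first by exists p0.
    by rewrite DE.
  exists d => x U; rewrite nbhsE => -[V [oV Vx] VU].
  have [|y [Vy /(@surj _ _ _ _ d)[i _ diy]]] := dD V _ oV; first by exists x.
  by exists i; apply: VU; rewrite diy.
pose W := fix W (s : seq nat) : set P :=
  if s is i :: t then W t `&` B (d i) (size t).+1%:R^-1 else setT.
have W_mono a m n : (m <= n)%N -> W (branch a n) `<=` W (branch a m).
  elim: n => [|n IH]; first by rewrite leqn0 => /eqP ->.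
  by rewrite leq_eqVlt => /predU1P[->//|/IH sub] x [/sub].
have size_branch (a : nat -> nat) n : size (branch a n) = n by elim: n => //= n ->.
have W_small a e : 0 < e -> exists N, forall m n, (N <= m)%N -> (N <= n)%N ->
    forall x y, W (branch a m) x -> W (branch a n) y -> B x e y.
  move=> e_gt0; have e2_gt0 : 0 < e / 2 by rewrite divr_gt0.
  have [N _ /(_ N (leqnn N)) /= Ne] := near_infty_natSinv_lt (PosNum e2_gt0).
  exists N.+1 => m n Nm Nn x y /(W_mono _ _ _ Nm)[_] + /(W_mono _ _ _ Nn)[_].
  rewrite size_branch => /(cballs_mono cB (ltW Ne)) dx /(cballs_mono cB (ltW Ne)) dy.
  by rewrite [e]splitr; apply: cballs_triangle dy => //; exact: cballs_sym.
exists W; split => //.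
  move=> s x Wx.
  have [|i di] := dD' x (B x (size s).+1%:R^-1); first exact: cballs_nbhsx.
  by exists i => //; split=> //; apply: cballs_sym di => //; rewrite invr_gt0.
move=> a /choice[u uW].
have [e e_gt0|p pP] := cballs_complete cB (u := u).
  have [N NP] := W_small a e e_gt0; exists N => m n Nm Nn.
  exact: (NP m n).
exists p => U /(cballs_nbhs cB)[e e_gt0 eU].
have e2_gt0 : 0 < e / 2 by rewrite divr_gt0.
have [N NP] := W_small a _ e2_gt0.
have [M MP] := pP _ e2_gt0.
exists N => n Nn x Wx; apply: eU; rewrite [e]splitr.
apply: (cballs_triangle cB (MP _ (leq_maxl M N))).
by apply: (NP _ n) (uW _) Wx => //; exact: leq_maxr.
Qed.

(** The scheme of the difference set is indexed by sequences of pairs: a pair of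
    branches of the scheme [W] of the parametrizing space is one branch here,
    which replaces a complete metric on the square of that space. *)
Lemma analytic_difference_comeager (R : realType) (X : topologicalZmodType)
    (A : set X) :
  polish R X -> analytic R A -> ~ meager (difference A) ->
  exists U : set X, [/\ open U, U !=set0 & meager (U `\` difference A)].
Proof.
move=> pX [P pP [f cf rf]] nm.
have hX : hausdorff_space X by exact: completely_metrizable_hausdorff pX.2.
have bX := polish_countable_base pX.
have [p0 _] : exists p0 : P, True.
  apply: contrapT => noP; apply: nm.
  suff -> : difference A = set0 by exact: meager0.
  rewrite -subset0 => x [a]; rewrite -rf => -[p _ _] _.
  by case: noP; exists p.
have [W [W0 Wcover Wlim]] := polish_scheme p0 pP.
pose S (s : seq (nat * nat)) : set X :=
  [set f p - f q | p in W (map fst s) & q in W (map snd s)].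
have S0 : S [::] = difference A.
  rewrite /S /= W0 -rf; apply/seteqP; split.
    by move=> _ [p _ [q _ <-]]; exists (f p); [exists p|exists (f q) => //; exists q].
  by move=> _ [_ [p _ <-] [_ [q _ <-] <-]]; exists p => //; exists q.
have branchE (T : Type) (g : nat * nat -> T) a n :
    map g (branch a n) = branch (g \o a) n by elim: n => //= n ->.
exists (interior (everywhere_nonmeager (S [::]))); split.
- exact: open_interior.
- have [||x [Sx _]] := interior_everywhere_nonmeager bX (S := S [::]) (O := setT).
  + exact: openT.
  + by rewrite setIT S0.
  + by exists x.
- rewrite -[in X in _ `\` X]S0; apply: (suslin_scheme_baire bX).
    move=> s _ [p /Wcover[i _ Wp] [q /Wcover[j _ Wq] <-]].
    by exists (i, j) => //; exists p => //; exists q.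
  move=> x a xcl.
  have Wn n : S (branch a n) !=set0.
    by have [|y [Sy _]] := xcl n setT; [exact: filterT|exists y].
  have [|p pP'] := Wlim (fst \o a).
    by move=> n; have [_ [p + _]] := Wn n; rewrite branchE; exists p.
  have [|q qP] := Wlim (snd \o a).
    by move=> n; have [_ [_ _ [q + _]]] := Wn n; rewrite branchE; exists q.
  have <- : f p - f q = x.
    apply: hX => U V pqU xV.
    have : nbhs (p, q) [set z : P * P | U (f z.1 - f z.2)].
      have c : {for (p, q), continuous (fun z : P * P => f z.1 - f z.2)}.
        apply: (@continuous_comp _ _ _ (fun z : P * P => (f z.1, f z.2))
          (fun z : X * X => z.1 - z.2)); last exact: sub_continuous.
        apply: cvg_pair => /=; apply: cvg_comp;
          [exact: cvg_fst|exact: cf|exact: cvg_snd|exact: cf].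
      exact: c.
    move=> [[U1 U2] /= [pU1 qU2] sub].
    have [N1 N1P] := pP' _ pU1; have [N2 N2P] := qP _ qU2.
    have [_ [[p' + [q' + <-]] Vpq]] := xcl (maxn N1 N2) _ xV.
    rewrite !branchE => /N1P U1p /N2P U2q.
    exists (f p' - f q'); split=> //; apply: (sub (p', q')); split.
      by apply: U1p; exact: leq_maxl.
    by apply: U2q; exact: leq_maxr.
  rewrite S0; exists (f p); first by rewrite -rf; exists p.
  by exists (f q) => //; rewrite -rf; exists q.
Qed.

Lemma nowhere_dense_preimage (T U : topologicalType) (f : T -> U) (g : U -> T)
    (N : set U) :
  continuous f -> continuous g -> cancel f g -> cancel g f ->
  nowhere_dense N -> nowhere_dense (f @^-1` N).
Proof.
move=> cf cg fK gK /nowhere_denseP N0; apply/nowhere_denseP => O oO [x Ox].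
have [||V [oV [y Vy] Vg VN]] := N0 (g @^-1` O).
- by apply: open_comp => // ? _; exact: cg.
- by exists (f x); rewrite /= fK.
exists (f @^-1` V); split.
- by apply: open_comp => // ? _; exact: cf.
- by exists (g y); rewrite /= gK.
- by move=> z /Vg /=; rewrite fK.
- by apply/seteqP; split=> // z [Vz Nz]; have : set0 (f z) by rewrite -VN.
Qed.

Lemma meager_preimage (T U : topologicalType) (f : T -> U) (g : U -> T)
    (N : set U) :
  continuous f -> continuous g -> cancel f g -> cancel g f ->
  meager N -> meager (f @^-1` N).
Proof.
move=> cf cg fK gK [F F0 NF]; exists (fun n => f @^-1` F n).
  by move=> n; exact: nowhere_dense_preimage (F0 n).
by move=> x /NF[n _ Fx]; exists n.
Qed.

Section topological_group.
Context {X : topologicalZmodType}.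
Implicit Types A D U : set X.

Lemma addl_continuous (x : X) : continuous (fun y : X => x + y).
Proof.
move=> y; apply: (@continuous_comp _ _ _ (fun y => (x, y)) (fun z : X * X => z.1 + z.2)).
  by apply: cvg_pair => /=; [exact: cvg_cst|exact: cvg_id].
exact: add_continuous.
Qed.

Lemma subl_continuous (x : X) : continuous (fun y : X => x - y).
Proof.
move=> y; apply: (@continuous_comp _ _ _ -%R (fun z => x + z)).
  exact: opp_continuous.
exact: addl_continuous.
Qed.

Lemma mulrn_continuous n : continuous (fun y : X => y *+ n).
Proof.
elim: n => [|n IH] y; first by rewrite (_ : (fun _ => _) = fun=> 0)//; exact: cvg_cst.
rewrite (_ : (fun y : X => _) = fun y => y + y *+ n); last first.
  by apply/funext => z; rewrite mulrS.
apply: (@continuous_comp _ _ _ (fun y => (y, y *+ n)) (fun z : X * X => z.1 + z.2)).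
  by apply: cvg_pair => /=; [exact: cvg_id|exact: IH].
exact: add_continuous.
Qed.

(** For small x the open set U meets U + x. Up to meager sets these lie in D and
    D + x, which therefore meet, as nonempty open sets are not meager. *)
Lemma pettis D U : (forall S : set X, meager S -> interior S = set0) ->
  open U -> U !=set0 -> meager (U `\` D) -> nbhs 0 (difference D).
Proof.
move=> bX oU [u Uu] mUD.
have : nbhs (0 : X) [set x | U (u - x)].
  apply: (@subl_continuous u 0 U); rewrite subr0; exact: open_nbhs_nbhs.
apply: filterS => x /= Uux.
pose O := U `&` [set y | U (- x + y)].
have oO : open O.
  by apply: openI => //; apply: open_comp => // y _; exact: addl_continuous.
have Ou : O u by split=> //=; rewrite addrC.
have [y [Dy Dyx]] : exists y, D y /\ D (- x + y).
  apply: contrapT => nD.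
  have mO : meager O.
    have xK : cancel (fun y => - x + y) (fun y => x + y).
      by move=> y; rewrite addrA subrr add0r.
    have Kx : cancel (fun y => x + y) (fun y => - x + y).
      by move=> y; rewrite addrA addNr add0r.
    have mUDx := meager_preimage (@addl_continuous (- x)) (@addl_continuous x) xK Kx mUD.
    apply: meager_sub (meagerU mUD mUDx) => y [Uy Uxy].
    have [Dy|nDy] := pselect (D y); last by left.
    by right; split=> // Dxy; apply: nD; exists y.
  have : interior O u by exact: open_nbhs_nbhs.
  by rewrite bX.
by exists y => //; exists (- x + y) => //; rewrite opprD opprK addrCA subrr addr0.
Qed.

(** If 2z = (a - b) + (c - d) and y is a midpoint of b and d, then z + y is a
    midpoint of a and c. *)
Lemma mid_convex_difference A : mid_convex A -> mid_convex (difference A).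
Proof.
move=> mA _ _ [a Aa [b Ab <-]] [c Ac [d Ad <-]].
have [[x xac] acA] := mA a c Aa Ac.
have [[y ybd] bdA] := mA b d Ab Ad.
split.
  by exists (x - y); rewrite /Defs.half /= [LHS]addrACA xac -opprD ybd opprD [LHS]addrACA.
move=> z zP; have zy : Defs.half (a + c) (z + y).
  by rewrite /Defs.half /= [LHS]addrACA zP ybd [a - b + _]addrACA -opprD subrK.
by exists (z + y); [exact: acA|exists y; [exact: bdA|exact: addrK]].
Qed.

(** The difference set D is symmetric, so the midpoints of D - D are midpoints
    of two elements of D. *)
Lemma nbhs_difference_mid_convex A : mid_convex A ->
  nbhs 0 (difference (difference A)) -> nbhs 0 (difference A).
Proof.
move=> /mid_convex_difference mD DD.
have : nbhs (0 : X) [set v | difference (difference A) (v *+ 2)].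
  by apply: (@mulrn_continuous 2 0 _); rewrite mul0rn.
apply: filterS => v /= [d Dd [e [a Aa [b Ab <-]] dev]].
have De : difference A (b - a) by exists b => //; exists a.
by have [_] := mD _ _ Dd De; apply; rewrite /Defs.half /= -(opprB a b) dev mulr2n.
Qed.

End topological_group.

Lemma mid_convex_meager_difference (R : realType) (X : topologicalZmodType)
    (A : set X) :
  polish R X -> analytic R A -> mid_convex A ->
  ~ nbhs (0 : X) (difference A) -> meager (difference A).
Proof.
move=> pX aA mA nD; apply: contrapT => nm; apply: nD.
apply: nbhs_difference_mid_convex => //.
have [U [oU U0 mU]] := analytic_difference_comeager pX aA nm.
have [B cB] := completely_metrizable_balls pX.2.
exact: pettis (baire_category cB) oU U0 mU.
Qed.

(** * Midpoints and null sequences *)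

(** Means of 2^k points, by induction on k. All solutions z of the equation are
    needed, as division by 2 need not be unique: when 2^(k+1) z is the total and
    v is a mean of the second half, 2z - v is a mean of the first half, and z is
    a midpoint of 2z - v and v. *)
Lemma mid_convex_mean (X : topologicalZmodType) (A : set X) k (c : nat -> X) :
  mid_convex A -> (forall i, A (c i)) ->
  (exists z, z *+ 2 ^ k = \sum_(i < 2 ^ k) c i) /\
  (forall z, z *+ 2 ^ k = \sum_(i < 2 ^ k) c i -> A z).
Proof.
move=> mA; elim: k c => [|k IH] c Ac.
  rewrite expn0 big_ord1; split; first by exists (c 0%N).
  by move=> z; rewrite mulr1n => ->.
have [[u uS] S1A] := IH c Ac.
have [[v vS] S2A] := IH (fun i => c (2 ^ k + i)%N) (fun i => Ac _).
have sumE : \sum_(i < 2 ^ k.+1) c i =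
    \sum_(i < 2 ^ k) c i + \sum_(i < 2 ^ k) c (2 ^ k + i)%N.
  by rewrite expnS mul2n -addnn big_split_ord.
rewrite sumE; have [[w wuv] uvA] := mA u v (S1A u uS) (S2A v vS).
split.
  by exists w; rewrite expnS mulrnA mulr2n wuv mulrnDl uS vS.
move=> z zS; have uz : A (z + z - v).
  apply: S1A; rewrite mulrnBl vS -mulr2n -mulrnA mulnC.
  by rewrite -[(2 ^ k * 2)%N]mulnC -expnS zS addrK.
have [_] := mA _ _ uz (S2A v vS); apply.
by rewrite /Defs.half /= subrK.
Qed.

(** Write 2^k y_i = a_i - b_i with a_i, b_i in A, and let x be a mean of the b_i.
    Then x + y_j is a mean of the same family with b_j replaced by a_j. *)
Lemma mid_convex_translate (X : topologicalZmodType) (A : set X) k (y : nat -> X) :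
  mid_convex A -> (forall i, difference A (y i *+ 2 ^ k)) ->
  exists x, forall i, (i < 2 ^ k)%N -> A (x + y i).
Proof.
move=> mA yD.
have /choice[p pP] : forall i, exists p : X * X,
    [/\ A p.1, A p.2 & p.1 - p.2 = y i *+ 2 ^ k].
  by move=> i; have [a Aa [b Ab ab]] := yD i; exists (a, b).
have Ap2 i : A (p i).2 by have [] := pP i.
have [[x xS] _] := mid_convex_mean k mA Ap2.
exists x => j jk; pose c i := if i == j then (p i).1 else (p i).2.
have Ac i : A (c i) by rewrite /c; case: (pP i); case: ifP.
have [_] := mid_convex_mean k mA Ac; apply.
have [_ _ pj] := pP j.
rewrite mulrnDl xS -pj (bigD1 (Ordinal jk))//= [RHS](bigD1 (Ordinal jk))//=.
rewrite {1}/c eqxx [LHS]addrC addrA subrK; congr (_ + _).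
by apply: eq_bigr => i /negbTE ij; rewrite /c -[j]/(val (Ordinal jk)) val_eqE ij.
Qed.

Lemma nbhs_omega_succ_None (U : set (order_topology omega_succ)) :
  nbhs (None : order_topology omega_succ) U ->
  exists N, forall n, (N <= n)%N -> U (Some n).
Proof.
rewrite order_nbhs_itv => -[[l r] [/= lro lrN] sub].
have [lN rN] : (l <= BLeft (None : order_topology omega_succ))%O /\
    (BRight (None : order_topology omega_succ) <= r)%O.
  by move: lrN; rewrite itv_boundlr => /andP.
have rP n : (BRight (Some n : order_topology omega_succ) <= r)%O.
  case: r lro rN {sub lrN} => [[] [m|]|[]]//; case: l {lN} => [[] [?|]|[]]//.
have [N NP] : exists N, forall n, (N <= n)%N ->
    (l <= BLeft (Some n : order_topology omega_succ))%O.
  case: l lro lN {sub lrN} => [[] [m|]|[]]//= lro _.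
  - exists m.+1 => n mn; rewrite bnd_simp ltNge.
    by change (~~ (n <= m)%N); rewrite -ltnNge.
  - by exists 0%N.
by exists N => n Nn; apply: sub; rewrite /= itv_boundlr NP// rP.
Qed.

(** 2^n > n far enough terms of the sequence, translated by minus the limit, are
    put into one translate of A by [mid_convex_translate]. *)
Lemma null_n_not_nbhs (X : topologicalZmodType) (A : set X) n :
  mid_convex A -> null_n n A -> ~ nbhs (0 : X) (difference A).
Proof.
move=> mA [f cf fA] D0.
have V0 : nbhs (0 : X) [set v | difference A (v *+ 2 ^ n)].
  by apply: (@mulrn_continuous X (2 ^ n) 0 _); rewrite mul0rn.
have : nbhs (f None) [set v | difference A ((- f None + v) *+ 2 ^ n)].
  apply: (@addl_continuous X (- f None) (f None)
    [set v | difference A (v *+ 2 ^ n)]).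
  by rewrite addNr.
move=> /cf/nbhs_omega_succ_None[N NP].
have [|x xA] := mid_convex_translate (k := n)
    (y := fun i => - f None + f (Some (N + i)%N)) mA.
  by move=> i; apply: NP; exact: leq_addr.
pose J := (fun i => Some (N + i)%N : order_topology omega_succ) @` `I_(2 ^ n).
have JI : J #= `I_(2 ^ n).
  by apply: inj_card_eq => i j _ _ [] /addnI.
have JA : J `<=` f @^-1` translate A (f None - x).
  move=> _ [i /xA Ai <-]; exists (x + (- f None + f (Some (N + i)%N))) => //.
  by rewrite addrC addrA subrK addrA subrr add0r.
have := card_le_trans (subset_card_le JA) (fA (f None - x)).
by rewrite (card_le_eql JI) card_le_II leqNgt ltn_expl.
Qed.

(** * Continuous maps on the Cantor cube *)

(** The cylinders of the Cantor cube are the fibers of this map; its values form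
    a finite type, which gives access to finite intersections. *)
Definition cantor_take k (x : cantor_space) : {ffun 'I_k -> bool} :=
  [ffun i : 'I_k => x i].

Definition cantor_pad k (s : {ffun 'I_k -> bool}) : cantor_space :=
  fun i => if insub i is Some j then s j else false.

Lemma cantor_takeP k x y : cantor_take k x = cantor_take k y <->
  forall i, (i < k)%N -> x i = y i.
Proof.
split=> [/ffunP E i ik|E]; first by have := E (Ordinal ik); rewrite !ffunE.
by apply/ffunP => i; rewrite !ffunE E.
Qed.

Lemma cantor_padK k : cancel (@cantor_pad k) (@cantor_take k).
Proof. by move=> s; apply/ffunP => i; rewrite ffunE /cantor_pad valK. Qed.

Lemma cantor_take_mono k m x y : (k <= m)%N ->
  cantor_take m x = cantor_take m y -> cantor_take k x = cantor_take k y.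
Proof.
move=> km /cantor_takeP E; apply/cantor_takeP => i ik; apply: E; exact: leq_trans km.
Qed.

Lemma nbhs_cantorP (x : cantor_space) U :
  nbhs x U <-> exists k, forall y, cantor_take k x = cantor_take k y -> U y.
Proof.
split=> [xU|[k kU]]; last first.
  suff : nbhs x [set y | cantor_take k x = cantor_take k y].
    by apply: filterS => y; exact: kU.
  have : nbhs x [set y : cantor_space | forall i : 'I_k, x i = y i].
    apply: (@filter_forall _ _
      (fun (i : 'I_k) (y : cantor_space) => x i = y i) (nbhs x)) => i.
    apply: (@proj_continuous nat (fun=> bool) i x [set b | x i = b]).
    by apply: open_nbhs_nbhs; split=> //; exact: discrete_open.
  by apply: filterS => y E; apply/ffunP => i; rewrite !ffunE.
pose F : set_system cantor_space :=
  [set V | exists k, forall y, cantor_take k x = cantor_take k y -> V y].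
have FF : Filter F.
  split.
  - by exists 0%N.
  - move=> P Q [k kP] [m mQ]; exists (maxn k m) => y E; split.
      by apply: kP; apply: cantor_take_mono E; exact: leq_maxl.
    by apply: mQ; apply: cantor_take_mono E; exact: leq_maxr.
  - by move=> P Q PQ [k kP]; exists k => y /kP /PQ.
have Fx : F --> x.
  apply/cvg_sup => i V [_ [[C oC <-] Cx sub]].
  exists i.+1 => y /cantor_takeP E; apply: sub.
  by rewrite /= /proj -E.
exact: Fx.
Qed.

Lemma compact_cylinder k (s : {ffun 'I_k -> bool}) :
  compact [set x | cantor_take k x = s].
Proof.
rewrite -[X in compact X]setTI.
apply: compact_closedI; first exact: cantor_space_compact.
rewrite -[X in closed X]setCK; apply: open_closedC.
rewrite openE => x /= xs; apply/nbhs_cantorP.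
by exists k => y E; rewrite /= -E.
Qed.

Lemma continuous_cantor_take (X : topologicalType) k (v : {ffun 'I_k -> bool} -> X) :
  continuous (fun x => v (cantor_take k x)).
Proof.
move=> x U /= Uv; apply/nbhs_cantorP; exists k => y E /=.
by rewrite -E; exact: nbhs_singleton.
Qed.

Section uniform.
Context {R : realType} {X : topologicalType} {B : X -> R -> set X}.
Hypothesis cB : complete_balls B.

Lemma uniform_continuity (f : cantor_space -> X) e : continuous f -> 0 < e ->
  exists k, forall x y, cantor_take k x = cantor_take k y -> B (f x) e (f y).
Proof.
move=> cf e_gt0; have e2_gt0 : 0 < e / 2 by rewrite divr_gt0.
have /compact_near_coveringP := cantor_space_compact.
move=> /(_ nat \oo (fun k x =>
  forall y, cantor_take k x = cantor_take k y -> B (f x) e (f y)) _).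
case.
  move=> x _; have /nbhs_cantorP[k kB] := cf _ _ (cballs_nbhsx cB (f x) e2_gt0).
  exists ([set y | cantor_take k x = cantor_take k y], [set m | (k <= m)%N]).
    split; last by exists k.
    by apply/nbhs_cantorP; exists k.
  move=> [y m] [/= xy km] z /(cantor_take_mono km) yz; rewrite [e]splitr.
  apply: (cballs_triangle cB (cballs_sym cB (kB _ xy))).
  by apply: kB; rewrite xy.
by move=> k _ /(_ k (leqnn k)) kP; exists k => x y; exact: kP.
Qed.

Import ArrowAsCompactOpen.
Local Notation C := (continuousType cantor_space X).

(** Finite intersections of subbasic open sets of the compact-open topology, one
    for each of the compact cylinders of depth k. *)
Lemma nbhs_cylinders k (f : C) (V : {ffun 'I_k -> bool} -> set X) :
  (forall s, open (V s)) -> (forall x, V (cantor_take k x) (f x)) ->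
  nbhs f [set g : C | forall x, V (cantor_take k x) (g x)].
Proof.
move=> oV fV.
have : nbhs f [set g : C | forall s,
    (g : cantor_space -> X) @` [set x | cantor_take k x = s] `<=` V s].
  apply: (@filter_forall _ _ (fun s (g : C) => (g : cantor_space -> X) @`
    [set x | cantor_take k x = s] `<=` V s) (nbhs f)) => s.
  apply: (@initial_continuous C {compact-open, cantor_space -> X} id f
    [set g | g @` [set x | cantor_take k x = s] `<=` V s]).
  apply: open_nbhs_nbhs; split.
    exact: (compact_open_open (compact_cylinder (s := s)) (oV s)).
  by move=> _ [x <- <-].
by apply: filterS => g gV x; apply: gV; exists x.
Qed.

(** As the Cantor cube is compact, the compact-open topology is the topology of
    uniform convergence. For one direction a compact set with image in an open
    set is thickened uniformly; for the other, f is almost constant on the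
    cylinders of some depth, so [nbhs_cylinders] applies. *)
Lemma nbhs_uniform (f : C) (U : set C) : nbhs f U <->
  exists2 e, 0 < e & [set g : C | forall x, B (f x) e (g x)] `<=` U.
Proof.
split.
  move=> [_ [[W oW <-] Wf] sub].
  pose F : set_system (cantor_space -> X) :=
    [set V | exists2 e, 0 < e & forall g, (forall x, B (f x) e (g x)) -> V g].
  have FF : Filter F.
    split.
    - by exists 1.
    - move=> P Q [d d_gt0 dP] [e e_gt0 eQ].
      exists (Num.min d e); first by rewrite lt_min d_gt0.
      move=> g fg; split; [apply: dP|apply: eQ] => x; apply: cballs_mono (fg x) => //;
      by rewrite ge_min lexx ?orbT.
    - by move=> P Q PQ [e e_gt0 eP]; exists e => // g /eP /PQ.
  have : F --> (f : {compact-open, cantor_space -> X}).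
    apply/compact_open_cvgP => K O cK oO fKO.
    have /compact_near_coveringP/near_covering_withinP := cK.
    move=> /(_ nat \oo (fun n x => B (f x) n.+1%:R^-1 `<=` O) _).
    case.
      move=> x Kx; have /(cballs_nbhs cB)[e e_gt0 eO] : nbhs (f x) O.
        by apply: open_nbhs_nbhs; split=> //; apply: fKO; exists x.
      have e2_gt0 : 0 < e / 2 by rewrite divr_gt0.
      exists ([set y | B (f x) (e / 2) (f y)], [set n | n.+1%:R^-1 < e / 2]).
        split; last exact: near_infty_natSinv_lt (PosNum e2_gt0).
        apply: (@cts_fun _ _ f x); exact: cballs_nbhsx.
      move=> [y n] [/= xy ne] Ky z /(cballs_mono cB (ltW ne)) yz.
      by apply: eO; rewrite [e]splitr; exact: cballs_triangle yz.
    move=> n _ /(_ n (leqnn n)) nP; exists n.+1%:R^-1; first by rewrite invr_gt0.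
    by move=> g fg _ [x Kx <-]; apply: (nP x Kx); exact: fg.
  move=> /(_ W)[|e e_gt0 eW]; first by apply: open_nbhs_nbhs; split.
  by exists e => // g /eW; exact: sub.
move=> [e e_gt0 eU].
have e4_gt0 : 0 < e / 4 by rewrite divr_gt0.
have [k kP] := uniform_continuity (@cts_fun _ _ f) e4_gt0.
(* The point [cantor_pad (cantor_take k x)] serves as the representative of the
   cylinder of x; on it f varies by at most e / 4. *)
have fV x : interior (B (f (cantor_pad (cantor_take k x))) (e / 2)) (f x).
  apply/(cballs_nbhs cB); exists (e / 4) => // y xy.
  apply: (cballs_mono cB (d := e / 4 + e / 4)); first by lra.
  by apply: cballs_triangle xy => //; apply: kP; rewrite cantor_padK.
have oV (s : {ffun 'I_k -> bool}) :
  open (interior (B (f (cantor_pad s)) (e / 2))) by exact: open_interior.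
apply: filterS (nbhs_cylinders (k := k) oV fV) => g gV.
apply: eU => x /=; apply: (cballs_mono cB (d := e / 4 + e / 2)); first by lra.
have /interior_subset := gV x; apply: (cballs_triangle cB).
by apply: kP; rewrite cantor_padK.
Qed.

(** A uniform limit of continuous maps is continuous, so completeness passes
    from X to the space of maps. *)
Lemma complete_balls_continuous :
  complete_balls (fun (f : C) e => [set g : C | forall x, B (f x) e (g x)]).
Proof.
split.
- by move=> f e e_gt0 x; exact: cballs_center.
- by move=> f g e fg x; exact: cballs_sym.
- by move=> f g h d e fg gh x; exact: cballs_triangle (gh x).
- exact: nbhs_uniform.
move=> u uC.
have /choice[l lP] : forall x, exists l, forall e, 0 < e ->
    exists N, forall n, (N <= n)%N -> B l e (u n x).
  move=> x; apply: (cballs_complete cB) => e /uC[N NP].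
  by exists N => m n Nm Nn; exact: NP.
have lu e : 0 < e -> exists N, forall n x, (N <= n)%N -> B (l x) e (u n x).
  move=> e_gt0; have e2_gt0 : 0 < e / 2 by rewrite divr_gt0.
  have [N NP] := uC _ e2_gt0; exists N => n x Nn.
  have [M MP] := lP x _ e2_gt0.
  rewrite [e]splitr; apply: (cballs_triangle cB (MP (maxn M N) (leq_maxl _ _))).
  exact: (NP (maxn M N) n (leq_maxr _ _) Nn).
have cl : continuous l.
  move=> x U /= /(cballs_nbhs cB)[e e_gt0 eU].
  have e3_gt0 : 0 < e / 3 by rewrite divr_gt0.
  have [N NP] := lu _ e3_gt0.
  have xN : nbhs x (u N @^-1` B (u N x) (e / 3)).
    by apply: (@cts_fun _ _ (u N) x); exact: cballs_nbhsx.
  apply: filterS xN => y /= xy; apply: eU.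
  rewrite (_ : e = e / 3 + (e / 3 + e / 3)); last by lra.
  apply: (cballs_triangle cB (NP N x (leqnn N))).
  by apply: (cballs_triangle cB xy); apply: cballs_sym => //; exact: NP.
exists (mkcts cl : C) => e /lu[N NP]; exists N => n Nn x.
exact: NP.
Qed.

End uniform.

(** * Generic maps and translates *)

Lemma card_le_I1P (T : Type) (A : set T) : A #<= `I_1 <-> is_subset1 A.
Proof.
split=> [/pcard_leP[f] x y Ax Ay|A1].
  have f0 z : A z -> f z = 0%N.
    by move=> Az; have := @funS _ _ A `I_1 f z Az; rewrite /= ltnS leqn0 => /eqP.
  by apply: (@inj _ _ _ f); rewrite ?inE//; exact: etrans (f0 x Ax) (esym (f0 y Ay)).
have [[x Ax]|/nonemptyPn ->] := pselect (A !=set0); last exact: card_ge0.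
apply: card_le_trans (_ : [set x] #<= `I_1).
  by apply: subset_card_le => y Ay; exact: A1.
by rewrite (card_le_eql card_set1).
Qed.

Section separation.
Context {X : topologicalZmodType}.
Implicit Types F G H : set X.

(** For a fixed h in H the differences g - h, with g in G, fill a nonempty open
    set, hence contain one outside the closure of F; small neighborhoods of
    such g and h do the job by continuity of the subtraction. *)
Lemma nowhere_dense_separation2 F G H : nowhere_dense F ->
  open G -> G !=set0 -> open H -> H !=set0 ->
  exists G' H', [/\ [/\ open G', G' !=set0 & G' `<=` G],
    [/\ open H', H' !=set0 & H' `<=` H] &
    forall u v, G' u -> H' v -> ~ F (u - v)].
Proof.
move=> /nowhere_denseP F0 oG [g Gg] oH [h Hh].
have [||W [oW [w Ww] WG WF]] := F0 [set z | G (h + z)].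
- by apply: open_comp => // z _; exact: addl_continuous.
- by exists (g - h); rewrite /= addrC subrK.
have whW : nbhs (h + w, h) [set z : X * X | W (z.1 - z.2)].
  apply: (@sub_continuous X (h + w, h) W) => /=.
  by rewrite addrAC subrr add0r; exact: open_nbhs_nbhs.
have [[U1 U2] /= [wU1 hU2] sub] := whW.
exists (G `&` interior U1), (H `&` interior U2); split.
- split; [|exists (h + w); split=> //; exact: WG|exact: subIsetl].
  by apply: openI => //; exact: open_interior.
- split; [|by exists h|exact: subIsetl].
  by apply: openI => //; exact: open_interior.
- move=> u v [_ /interior_subset Uu] [_ /interior_subset Uv] Fuv.
  have : set0 (u - v) by rewrite -WF; split=> //; exact: (sub (u, v)).
  by [].
Qed.

(** The open sets are shrunk for one pair of indices after the other; what has
    been gained for a pair survives any later shrinking. *)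
Lemma nowhere_dense_separation (I : finType) F (G : I -> set X) :
  nowhere_dense F -> (forall i, open (G i)) -> (forall i, G i !=set0) ->
  exists G' : I -> set X,
    [/\ forall i, open (G' i), forall i, G' i !=set0,
        forall i, G' i `<=` G i &
        forall i j, i != j -> forall u v, G' i u -> G' j v -> ~ F (u - v)].
Proof.
move=> F0 oG G0.
suff /(_ (enum (predT : pred (I * I))))[G' [oG' G'0 G'G G'F]] :
    forall s : seq (I * I), exists G' : I -> set X,
    [/\ forall i, open (G' i), forall i, G' i !=set0,
        forall i, G' i `<=` G i &
        forall i j, (i, j) \in s -> i != j ->
          forall u v, G' i u -> G' j v -> ~ F (u - v)].
    by exists G'; split => // i j; apply: G'F; rewrite mem_enum.
elim=> [|[i j] s [G' [oG' G'0 G'G G'F]]]; first by exists G; split => // i x.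
have [<-|ij] := eqVneq i j.
  exists G'; split => // a b; rewrite inE => /predU1P[[-> ->]|]; last exact: G'F.
  by rewrite eqxx.
have [H [K [[oH H0 HG] [oK K0 KG] HK]]] :=
  nowhere_dense_separation2 F0 (oG' i) (G'0 i) (oG' j) (G'0 j).
pose L a := if a == i then H else if a == j then K else G' a.
have LG' a : L a `<=` G' a.
  by rewrite /L; case: eqP => [->|_]; [exact: HG|case: eqP => [->|_ x]; [exact: KG|]].
exists L; split.
- by move=> a; rewrite /L; case: ifP => // _; case: ifP.
- by move=> a; rewrite /L; case: ifP => // _; case: ifP.
- by move=> a; exact: subset_trans (LG' a) (G'G a).
- move=> a b; rewrite inE => /predU1P[[-> ->] _ u v|abs ab u v /LG' + /LG'].
    by rewrite /L eqxx eq_sym (negbTE ij) eqxx; exact: HK.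
  exact: G'F.
Qed.

End separation.

Section function_space.
Context {R : realType} {X : topologicalZmodType}.
Hypothesis mX : completely_metrizable R X.
Implicit Types A F : set X.

Import ArrowAsCompactOpen.
Local Notation C := (continuousType cantor_space X).

(** Near f there is a map g that is constant on the cylinders of some depth
    k >= m, whose values lie in open sets with pairwise differences outside F.
    All maps that send each cylinder into its open set share this property, and
    they form a neighborhood of g. *)
Lemma nowhere_dense_hit F m : nowhere_dense F ->
  nowhere_dense [set f : C | exists x y,
    cantor_take m x != cantor_take m y /\ F (f x - f y)].
Proof.
have [B cB] := completely_metrizable_balls mX.
move=> F0; apply/nowhere_denseP => W oW [f Wf].
have /(nbhs_uniform cB)[e e_gt0 eW] : nbhs f W by exact: open_nbhs_nbhs.
have e2_gt0 : 0 < e / 2 by rewrite divr_gt0.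
have [k0 k0P] := uniform_continuity cB (@cts_fun _ _ f) e2_gt0.
pose k := maxn k0 m.
have [||G [oG G0 GB GF]] := nowhere_dense_separation
    (G := fun s : {ffun 'I_k -> bool} => interior (B (f (cantor_pad s)) (e / 2))) F0.
- by move=> s; exact: open_interior.
- by move=> s; exists (f (cantor_pad s)); exact: cballs_nbhsx.
pose V := [set h : C | forall x, G (cantor_take k x) (h x)].
have /choice[v vG] := G0.
pose g : C := mkcts (@continuous_cantor_take X k v).
have gV : nbhs g V by apply: nbhs_cylinders => // x; exact: vG.
exists (interior V); split.
- exact: open_interior.
- by exists g.
- move=> h /interior_subset Vh; apply: eW => x.
  have /interior_subset Gx := GB _ _ (Vh x).
  rewrite [e]splitr; apply: (cballs_triangle cB) Gx; apply: k0P.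
  by apply: (cantor_take_mono (leq_maxl k0 m)); rewrite cantor_padK.
- rewrite -subset0 => h [/interior_subset Vh [x [y [xy]]]].
  apply: (GF (cantor_take k x) (cantor_take k y)) => //.
  by apply: contra_neq xy; apply: cantor_take_mono; exact: leq_maxr.
Qed.

(** Distinct points of the Cantor cube differ within the first m coordinates for
    some m, so the exceptional maps are covered by countably many of the nowhere
    dense sets of [nowhere_dense_hit]. *)
Lemma meager_generically_haar1 A : meager (difference A) -> generically_haar1 A.
Proof.
move=> [F F0 DF].
apply: meager_sub (meager_bigcup (F := fun p : nat * nat => [set f : C |
    exists x y, cantor_take p.1 x != cantor_take p.1 y /\ F p.2 (f x - f y)]) _).
  move=> f /existsNP[z fz].
  have [x [y [fx fy xy]]] : exists x y, [/\ (f @^-1` translate A z) x,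
      (f @^-1` translate A z) y & x <> y].
    apply: contrapT => nxy; apply: fz; apply/card_le_I1P => x y fx fy.
    by apply: contrapT => xy; apply: nxy; exists x, y.
  have [n xyn] : exists n, cantor_take n x != cantor_take n y.
    apply: contrapT => nn; apply: xy; apply/funext => i.
    have /eqP/cantor_takeP -> // : cantor_take i.+1 x == cantor_take i.+1 y.
    by apply: contrapT => /negP E; apply: nn; exists i.+1.
  have [k _ Fk] : (\bigcup_n F n) (f x - f y).
    apply: DF; case: fx => a Aa <-; case: fy => b Ab <-.
    by exists a => //; exists b => //; rewrite opprD addrACA subrr addr0.
  by exists (n, k) => //; exists x, y.
by move=> p; apply: nowhere_dense_meager; exact: nowhere_dense_hit.
Qed.

(** The space of maps is nonempty, so by Baire a comeager set of maps is
    nonempty too. *)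
Lemma generically_haar1_injective A : generically_haar1 A ->
  exists f : C, forall x y z, translate A z (f x) -> translate A z (f y) -> x = y.
Proof.
have [B cB] := completely_metrizable_balls mX.
move=> gA; have [f fP] : exists f : C, forall z, f @^-1` translate A z #<= `I_1.
  apply: contrapT => nf.
  have : meager [set: C].
    by apply: meager_sub gA => f _ fP; apply: nf; exists f.
  move=> /(baire_category (complete_balls_continuous cB)) C0.
  have c0 : continuous (fun _ : cantor_space => 0 : X) by move=> x; exact: cvg_cst.
  have : interior [set: C] (mkcts c0) by exact: filterT.
  by rewrite C0.
by exists f => x y z fx fy; have /card_le_I1P := fP z; exact.
Qed.

End function_space.

Definition zeros : cantor_space := fun=> false.

Definition spike (n : nat) : cantor_space := fun i => i == n.

Lemma nbhs_spike U : nbhs zeros U ->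
  exists N, forall n, (N <= n)%N -> U (spike n).
Proof.
move=> /nbhs_cantorP[k kU]; exists k => n kn; apply: kU.
apply/cantor_takeP => i ik; rewrite /spike; apply/esym/negbTE.
by rewrite neq_ltn (leq_trans ik kn).
Qed.

(** The points [zeros] and [spike N] differ in the coordinate N only, so they
    cannot both lie in one thin set. *)
Lemma haar_thin_not_nbhs (X : topologicalZmodType) (A : set X) :
  haar_thin A -> ~ nbhs (0 : X) (difference A).
Proof.
move=> [f cf fA] D0.
have : nbhs (f zeros) [set v | difference A (- f zeros + v)].
  by apply: (@addl_continuous X (- f zeros) (f zeros) (difference A)); rewrite addNr.
move=> /cf/nbhs_spike[N /(_ N (leqnn N))[a Aa [b Ab ab]]].
have := fA (f zeros - b) N (spike N) zeros.
rewrite !inE /=.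
have tz : translate A (f zeros - b) (f zeros) by exists b => //; rewrite addrC subrK.
have ts : translate A (f zeros - b) (f (spike N)).
  by exists a => //; rewrite addrCA ab addrA subrr add0r.
move=> /(_ ts tz) E; have /(congr1 (fun x : cantor_space => x N)) : spike N = zeros.
  apply: E; apply/funext => -[i iN]; rewrite /sigL /= /spike.
  by apply/negbTE/eqP => iN'; have := set_mem iN; apply.
by rewrite /spike eqxx.
Qed.

(** All points except the top one are isolated: the interval between the two
    neighbors of [Some n] is a singleton, with a ray in place of an interval for
    n = 0. *)
Lemma continuous_omega_succ (X : topologicalType)
    (g : order_topology omega_succ -> X) :
  (forall U, nbhs (g None) U -> exists N, forall n, (N <= n)%N -> U (g (Some n))) ->
  continuous g.
Proof.
pose T := order_topology omega_succ.
move=> gP [n|] U /= Ug; rewrite nbhs_simpl/= order_nbhs_itv.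
  have lt_Some i j : ((Some i : T) < Some j)%O = (i < j)%N.
    by rewrite ltNge ltnNge.
  pose l : itv_bound T := if n is m.+1 then BRight (Some m : T) else -oo%O.
  exists (Interval l (BLeft (Some n.+1 : T))).
    rewrite /l {l}; split; first by case: n {Ug}.
    by case: n {Ug} => [|m]; rewrite itv_boundlr ?bnd_simp !lt_Some ?ltnSn.
  move=> w; rewrite /= itv_boundlr bnd_simp => /andP[lw wr].
  suff -> : w = Some n by exact: nbhs_singleton.
  case: w lw wr => [m|_]; last by rewrite ltNge.
  rewrite lt_Some ltnS => lm mn; congr Some; apply/eqP; rewrite eqn_leq mn /=.
  by move: lm; rewrite /l; case: n {Ug l mn} => // p; rewrite bnd_simp lt_Some.
have [N NP] := gP U Ug.
exists `]Some N, +oo[%O; first by split.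
move=> [m|] /= ; last by move=> _; exact: nbhs_singleton.
rewrite in_itv /= andbT => Nm; apply: NP; exact: ltW Nm.
Qed.

Lemma injective_null1 (X : topologicalZmodType) (A : set X) (f : cantor_space -> X) :
  continuous f ->
  (forall x y z, translate A z (f x) -> translate A z (f y) -> x = y) ->
  null_n 1 A.
Proof.
move=> cf fA.
exists (fun w => f (if w is Some n then spike n else zeros)).
  by apply: continuous_omega_succ => U /cf/nbhs_spike.
move=> z; apply/card_le_I1P => u v fu fv.
have := fA _ _ _ fu fv.
case: u v {fu fv} => [n|] [m|] //.
- by move=> /(congr1 (@^~ n)); rewrite /spike eqxx => /esym/eqP ->.
- by move=> /(congr1 (@^~ n)); rewrite /spike eqxx.
- by move=> /(congr1 (@^~ m)); rewrite /spike eqxx.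
Qed.

Theorem theorem19p3 (R : realType) (X : topologicalZmodType) (A : set X) :
  polish R X -> analytic R A -> mid_convex A ->
  [<-> ~ nbhs (0 : X) (difference A);
       meager (difference A);
       generically_haar1 A;
       haar_thin A;
       exists2 n : nat, (0 < n)%N & null_n n A].
Proof.
move=> pX aA mA.
have meagerD := mid_convex_meager_difference pX aA mA.
have haar1D := meager_generically_haar1 pX.2 (A := A).
tfae => //.
- move=> /(generically_haar1_injective pX.2)[f fA].
  by exists f => [|z n x y]; [exact: cts_fun|rewrite !inE => fx fy _; exact: fA fy].
- move=> /haar_thin_not_nbhs/meagerD/haar1D/(generically_haar1_injective pX.2)[f fA].
  by exists 1%N => //; apply: injective_null1 fA; exact: cts_fun.
- by move=> [n _]; exact: null_n_not_nbhs.
Qed.
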